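(* Let $(\Gamma,\Gamma_1,\Gamma_2)$ be an integral Gassmann triple with $m=[\Gamma:\Gamma_i]$, and let $\Gamma_1'\subset\Gamma_1$, $\Gamma_2'\subset\Gamma_2$ be corresponding subgroups of index $t$. If $\gcd(m,t)=1$, then $\Gamma_1'$ and $\Gamma_2'$ have the same normal core in $\Gamma$.
   Context: A triple of groups $(\Gamma,\Gamma_1,\Gamma_2)$ with $[\Gamma:\Gamma_i]<\infty$ is an integral Gassmann triple if $\mathbb{Z}[\Gamma/\Gamma_1]\simeq\mathbb{Z}[\Gamma/\Gamma_2]$ as $\mathbb{Z}\Gamma$-modules ($\Gamma$ acting on cosets by left multiplication). Homology is with trivial $\mathbb{Z}$ coefficients. Let $\Delta_i:\mathbb{Z}\to\mathbb{Z}[\Gamma/\Gamma_i]$, $n\mapsto n\sum_{x\in\Gamma/\Gamma_i}x$, and $\varepsilon_i$ the augmentation $\mathbb{Z}[\Gamma/\Gamma_i]\to\mathbb{Z}$. Fix a $\mathbb{Z}\Gamma$-isomorphism $\psi:\mathbb{Z}[\Gamma/\Gamma_1]\to\mathbb{Z}[\Gamma/\Gamma_2]$ with $\psi\circ\Delta_1=\Delta_2$ and $\varepsilon_2\circ\psi=\varepsilon_1$, and let $\varphi:H_1(\Gamma_1)\to H_1(\Gamma_2)$ be the composite of Shapiro's isomorphism $H_1(\Gamma_1,\mathbb{Z})\simeq H_1(\Gamma,\mathbb{Z}[\Gamma/\Gamma_1])$, the map induced by $\psi$, and Shapiro's isomorphism $H_1(\Gamma,\mathbb{Z}[\Gamma/\Gamma_2])\simeq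 H_1(\Gamma_2,\mathbb{Z})$. Subgroups $U_i\subset H_1(\Gamma_i)$ of finite index $t$ correspond if $\varphi(U_1)=U_2$; subgroups $\Gamma_i'\subset\Gamma_i$ correspond if $\Gamma_i'$ is the preimage of $U_i$ under the natural projection $\Gamma_i\to H_1(\Gamma_i)$ for corresponding $U_1,U_2$. *)

(* Defs.v *)
From HB Require Import structures.
From mathcomp Require Import all_boot all_order all_algebra.
From mathcomp Require Import finmap monalg.
From mathcomp Require Import boolp classical_sets functions cardinality fsbigop.

Set Implicit Arguments.
Unset Strict Implicit.
Unset Printing Implicit Defensive.

Import GRing.Theory.

Local Open Scope classical_set_scope.
Local Open Scope quotient_scope.
Local Open Scope ring_scope.

Section MalgLift.
Variables (K : choiceType) (M A : zmodType).

Definition mlift (F : K -> {additive M -> A}) (c : {malg M[K]}) : A :=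
  \sum_(k <- msupp c) F k c@_k.

Variable F : K -> {additive M -> A}.

Lemma mliftEw (c : {malg M[K]}) (d : {fset K}) :
  {subset msupp c <= d} -> mlift F c = \sum_(k <- d) F k c@_k.
Proof.
move=> /fsubsetP cd; rewrite /mlift; apply: big_fset_incl => // k kd.
by move=> /mcoeff_outdom ->; rewrite raddf0.
Qed.

Lemma mlift_is_zmod_morphism : zmod_morphism (mlift F).
Proof.
move=> a b; pose d := (msupp a `|` msupp b)%fset.
have ad : {subset msupp a <= d} by move=> k; rewrite in_fsetU => ->.
have bd : {subset msupp b <= d} by move=> k; rewrite in_fsetU orbC => ->.
have abd : {subset msupp (a - b) <= d} by apply/fsubsetP/msuppB_le.
rewrite (mliftEw ad) (mliftEw bd) (mliftEw abd) -sumrB.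
by apply: eq_bigr => k _; rewrite mcoeffB raddfB.
Qed.
HB.instance Definition _ :=
  GRing.isZmodMorphism.Build {malg M[K]} A (mlift F) mlift_is_zmod_morphism.

Lemma mliftU k x : mlift F << x *g k >> = F k x.
Proof.
rewrite (@mliftEw _ [fset k]%fset); last exact/fsubsetP/msuppU_le.
by rewrite big_seq_fset1 mcoeffUU.
Qed.

End MalgLift.

Lemma malg_ext (K : choiceType) (M A : zmodType)
    (f g : {additive {malg M[K]} -> A}) :
  (forall k x, f << x *g k >> = g << x *g k >>) -> f =1 g.
Proof.
move=> fg c; rewrite [c]monalgE !raddf_sum.
by apply: eq_bigr => k _; apply: fg.
Qed.

Lemma malgZ_ext (K : choiceType) (A : zmodType)
    (f g : {additive {malg int[K]} -> A}) :
  (forall k, f << k >> = g << k >>) -> f =1 g.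
Proof.
move=> fg; apply: malg_ext => k x.
by rewrite -[x]intz raddfMz !raddfMz fg.
Qed.

Section Subgroup.
Variables (G : groupType) (H : groupClosed G).
Local Open Scope group_scope.

Record subgroupT := SubgroupT { sg_val : G; sg_valP : sg_val \in H }.

HB.instance Definition _ := [isSub for sg_val].
HB.instance Definition _ := [Choice of subgroupT by <:].
Lemma subgroupT_closed : monoid.group_closed H.
Proof. by split=> [|x y xH yH]; [apply: gpred1 | apply: gpredF]. Qed.
HB.instance Definition _ :=
  SubChoice_isSubGroup.Build G (fun x => x \in H) subgroupT subgroupT_closed.

Definition cosetL_rel : rel G := fun x y => x^-1 * y \in H.

Lemma cosetL_rel_equiv : equiv_class_of cosetL_rel.
Proof.
split=> [x|x y|y x z]; rewrite /cosetL_rel ?mulVg ?gpred1 //.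
  by rewrite -(gpredV _ (_ * _)) invgM invgK.
by move=> xy yz; rewrite -[x^-1](mulgK y) -mulgA gpredM.
Qed.
Canonical cosetL_rel_equivRel := EquivRelPack cosetL_rel_equiv.

Definition coset_space := {eq_quot cosetL_rel}.
HB.instance Definition _ := EqQuotient.on coset_space.
HB.instance Definition _ := Choice.on coset_space.

Definition cosetL (x : G) : coset_space := \pi x.

Definition cosetL_act (g : G) (c : coset_space) : coset_space := cosetL (g * repr c).

Lemma cosetLP x y : reflect (cosetL x = cosetL y) (x^-1 * y \in H).
Proof. by apply: (iffP idP) => [h|/eqmodP//]; apply/eqmodP. Qed.

Lemma cosetL_repr c : cosetL (repr c) = c.
Proof. exact: reprK. Qed.

Lemma cosetL_actE g x : cosetL_act g (cosetL x) = cosetL (g * x).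
Proof.
apply/cosetLP; rewrite invgM -mulgA mulKg.
by apply/cosetLP; rewrite cosetL_repr.
Qed.

End Subgroup.

Record zgmod (G : groupType) := ZGMod {
  zg_sort :> zmodType;
  zg_act : G -> {additive zg_sort -> zg_sort};
  zg_act1 : forall m, zg_act 1%g m = m;
  zg_actM : forall g h m, zg_act (g * h)%g m = zg_act g (zg_act h m) }.
Arguments zg_act {G z} g.
Arguments zg_act1 {G z} m.
Arguments zg_actM {G z} g h m.

Record zghom (G : groupType) (M N : zgmod G) := ZGHom {
  zghom_fun :> {additive M -> N};
  zghom_act : forall g m, zghom_fun (zg_act g m) = zg_act g (zghom_fun m) }.

(* A morphism (G, M) -> (L, N) of groups with modules, with respect to which
   group homology is functorial. *)
Record pairhom (G L : groupType) (M : zgmod G) (N : zgmod L) := PairHom {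
  ph_grp : UMagmaMorphism.type G L;
  ph_mod : {additive M -> N};
  ph_act : forall g m, ph_mod (zg_act g m) = zg_act (ph_grp g) (ph_mod m) }.

Definition pair_of_zghom (G : groupType) (M N : zgmod G) (f : zghom M N) :
  pairhom M N := PairHom (ph_grp := idfun) (zghom_act f).

Definition trivmod (G : groupType) : zgmod G :=
  @ZGMod G int (fun=> idfun) (fun=> erefl) (fun _ _ _ => erefl).

Section PermutationModule.
Variables (G : groupType) (H : groupClosed G).

Definition permmod_act (g : G) :
    {malg int[coset_space H]} -> {malg int[coset_space H]} :=
  mlift (fun c => mkmalgU (cosetL_act g c)).
HB.instance Definition _ g := Algebra.Additive.on (permmod_act g).

Lemma permmod_actU g c : permmod_act g << c >> = << cosetL_act g c >>.
Proof. exact: mliftU. Qed.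

Lemma permmod_act1 m : permmod_act 1%g m = m.
Proof.
apply: (malgZ_ext (f := permmod_act 1%g) (g := idfun)) => c.
by rewrite /= permmod_actU -[c]cosetL_repr cosetL_actE mul1g.
Qed.

Lemma permmod_actM g h m :
  permmod_act (g * h)%g m = permmod_act g (permmod_act h m).
Proof.
apply: (malgZ_ext (f := permmod_act _)
  (g := permmod_act g \o permmod_act h)) => c /=.
by rewrite !permmod_actU -[c]cosetL_repr !cosetL_actE mulgA.
Qed.

(* Z[G/H] *)
Definition permmod : zgmod G := 
  @ZGMod G {malg int[coset_space H]} (fun g => permmod_act g)
    permmod_act1 permmod_actM.

(* The sum is over all of G/H, and is meant for H of finite index. *)
Definition permmod_diag (n : int) : permmod :=
  (\sum_(c \in [set: coset_space H])
    (<< c >> : {malg int[coset_space H]})) *~ n.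

Lemma permmod_diagE n c :
  finite_set [set: coset_space H] -> (permmod_diag n)@_c = n.
Proof.
move=> fin; rewrite /permmod_diag fsbig_finite //= raddfMz /= raddf_sum /=.
rewrite (big_fsetD1 c) /=; last by rewrite in_fset_set // inE.
rewrite mcoeffUU big1_fset ?addr0 ?intz // => d.
by rewrite in_fsetD1 mcoeffU => /andP[/negPf ->].
Qed.

Definition permmod_aug : permmod -> int :=
  mlift (fun=> idfun : {additive int -> int}).
HB.instance Definition _ := Algebra.Additive.on permmod_aug.

End PermutationModule.

Section Homology.
Variables (G : groupType) (M : zgmod G).

(* Chains of degrees 1 and 2 of the complex M (x)_{ZG} B, with B the bar
   resolution of Z, where M is a right module by m g := g^-1 m;
   << m *g g >> stands for m (x) [g] and << m *g (g, h) >> for m (x) [g|h].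
   Degree 0 is M itself. *)
Definition chain1 := {malg M[G]}.
Definition chain2 := {malg M[(G * G)%type]}.

Definition bar_d1 : chain1 -> M :=
  mlift (fun g => zg_act g^-1%g \- idfun : {additive M -> M}).
HB.instance Definition _ := Algebra.Additive.on bar_d1.

Definition bar_d2 : chain2 -> chain1 :=
  mlift (fun gh : G * G =>
    (mkmalgU gh.2 \o zg_act gh.1^-1%g) \- mkmalgU (gh.1 * gh.2)%g
    \+ mkmalgU gh.1 : {additive M -> chain1}).
HB.instance Definition _ := Algebra.Additive.on bar_d2.

Record cycle1 := Cycle1 { cycle1_val : chain1; _ : bar_d1 cycle1_val == 0 }.

HB.instance Definition _ := [isSub for cycle1_val].
HB.instance Definition _ := [Choice of cycle1 by <:].
Fact cycle1_closed : zmod_closed (fun z : chain1 => bar_d1 z == 0).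
Proof.
split=> [|a b]; rewrite ?unfold_in ?raddf0 // => /eqP a0 /eqP b0.
by rewrite raddfB /= a0 b0 subrr.
Qed.
HB.instance Definition _ := GRing.SubChoice_isSubZmodule.Build chain1
  (fun z : chain1 => bar_d1 z == 0) cycle1 cycle1_closed.

Definition boundary1 : {pred cycle1} :=
  fun z => `[< exists c : chain2, bar_d2 c = val z >].

Fact boundary1_closed : zmod_closed boundary1.
Proof.
split=> [|a b]; rewrite ?unfold_in.
  by apply/asboolP; exists 0; rewrite raddf0 raddf0.
move=> /asboolP[c ec] /asboolP[d ed]; apply/asboolP; exists (c - d).
by rewrite [LHS]raddfB [RHS]raddfB; congr (_ - _).
Qed.
HB.instance Definition _ := GRing.isZmodClosed.Build cycle1 boundary1
  boundary1_closed.

(* H_1(G, M) *)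
Definition H1 : zmodType := Quotient.quot boundary1.

Definition homcl (z : cycle1) : H1 := \pi_(Quotient.quot boundary1) z.

End Homology.
Arguments bar_d1 {G M} _ : simpl never.
Arguments bar_d2 {G M} _ : simpl never.

Section Boundaries.
Variables (G : groupType) (M : zgmod G).

Definition bdry : {pred chain1 M} := fun z => `[< exists c, bar_d2 c = z >].

Fact bdry_closed : zmod_closed bdry.
Proof.
split=> [|a b]; rewrite ?unfold_in.
  by apply/asboolP; exists 0; rewrite raddf0.
move=> /asboolP[c ec] /asboolP[d ed]; apply/asboolP; exists (c - d).
by rewrite raddfB; congr (_ - _).
Qed.
HB.instance Definition _ := GRing.isZmodClosed.Build (chain1 M) bdry
  bdry_closed.

Definition modb : chain1 M -> Quotient.quot bdry :=
  \pi_(Quotient.quot bdry).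
HB.instance Definition _ := Algebra.Additive.on modb.

Lemma modbP a b : modb a = modb b <-> exists c, bar_d2 c = a - b.
Proof.
split=> [/eqP|ab]; first by rewrite -Quotient.idealrBE => /asboolP.
by apply/eqP; rewrite -Quotient.idealrBE; apply/asboolP.
Qed.

Lemma bar_d1U g (m : M) : bar_d1 << m *g g >> = zg_act g^-1%g m - m.
Proof. exact: mliftU. Qed.

Lemma bar_d2U g h (m : M) : bar_d2 << m *g (g, h) >> =
  << zg_act g^-1%g m *g h >> - << m *g (g * h)%g >> + << m *g g >>.
Proof. exact: mliftU. Qed.

Lemma modbM g h (m : M) : modb << m *g (g * h)%g >> =
  modb << m *g g >> + modb << zg_act g^-1%g m *g h >>.
Proof.
apply/esym; rewrite -raddfD; apply/modbP; exists << m *g (g, h) >>.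
by rewrite bar_d2U addrAC [X in X - _]addrC.
Qed.

Lemma modb1 (m : M) : modb << m *g 1%g >> = 0.
Proof.
have := modbM 1%g 1%g m; rewrite mulg1 invg1 zg_act1 => /eqP.
by rewrite -subr_eq0 opprD addrA subrr sub0r oppr_eq0 => /eqP.
Qed.

Lemma homcl_eq (a b : cycle1 M) :
  homcl a = homcl b <-> modb (val a) = modb (val b).
Proof.
rewrite modbP -raddfB; split=> [/eqP|ab].
  by rewrite -Quotient.idealrBE => /asboolP.
by apply/eqP; rewrite -Quotient.idealrBE; apply/asboolP.
Qed.

Lemma homcl_repr (x : H1 M) : homcl (repr x) = x.
Proof. exact: reprK. Qed.

Lemma homclD (a b : cycle1 M) : homcl (a + b) = homcl a + homcl b.
Proof. exact: raddfD. Qed.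

Lemma homclB (a b : cycle1 M) : homcl (a - b) = homcl a - homcl b.
Proof. exact: raddfB. Qed.

End Boundaries.
Arguments modb {G M} _ : simpl never.

Section Functoriality.
Variables (G L : groupType) (M : zgmod G) (N : zgmod L) (f : pairhom M N).

Definition chain1_map : chain1 M -> chain1 N :=
  mlift (fun g => mkmalgU (ph_grp f g) \o ph_mod f : {additive M -> chain1 N}).
HB.instance Definition _ := Algebra.Additive.on chain1_map.

Definition chain2_map : chain2 M -> chain2 N :=
  mlift (fun gh : G * G => mkmalgU (ph_grp f gh.1, ph_grp f gh.2) \o ph_mod f
    : {additive M -> chain2 N}).
HB.instance Definition _ := Algebra.Additive.on chain2_map.

Lemma chain1_mapU g m : chain1_map << m *g g >> = << ph_mod f m *g ph_grp f g >>.
Proof. exact: mliftU. Qed.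

Lemma chain2_mapU gh m : chain2_map << m *g gh >> =
  << ph_mod f m *g (ph_grp f gh.1, ph_grp f gh.2) >>.
Proof. exact: mliftU. Qed.

Lemma bar_d1_map z : bar_d1 (chain1_map z) = ph_mod f (bar_d1 z).
Proof.
apply: (malg_ext (f := bar_d1 (M := N) \o chain1_map)
  (g := ph_mod f \o bar_d1 (M := M))) => g m /=.
by rewrite chain1_mapU !bar_d1U raddfB ph_act gmulfV.
Qed.

Lemma bar_d2_map c : bar_d2 (chain2_map c) = chain1_map (bar_d2 c).
Proof.
apply: (malg_ext (f := bar_d2 (M := N) \o chain2_map)
  (g := chain1_map \o bar_d2 (M := M))) => -[g h] m /=.
rewrite chain2_mapU /= !bar_d2U raddfD raddfB /= !chain1_mapU.
by rewrite ph_act gmulfV gmulfM.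
Qed.

Fact cycle1_map_subproof (z : cycle1 M) : bar_d1 (chain1_map (val z)) == 0.
Proof. by rewrite bar_d1_map (eqP (valP z)) raddf0. Qed.

Definition cycle1_map (z : cycle1 M) : cycle1 N :=
  Cycle1 (cycle1_map_subproof z).

Definition H1_map (x : H1 M) : H1 N := homcl (cycle1_map (repr x)).

Lemma modb_map a b :
  modb a = modb b -> modb (chain1_map a) = modb (chain1_map b).
Proof.
move=> /modbP[c ec]; apply/modbP; exists (chain2_map c).
by rewrite bar_d2_map ec raddfB.
Qed.

Lemma H1_mapE z : H1_map (homcl z) = homcl (cycle1_map z).
Proof.
by apply/homcl_eq/modb_map; apply/homcl_eq; rewrite homcl_repr.
Qed.

Lemma H1_map_is_zmod_morphism : zmod_morphism H1_map.
Proof.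
move=> x y; rewrite -[x]homcl_repr -[y]homcl_repr -homclB !H1_mapE -homclB.
by congr homcl; apply/val_inj; rewrite /= !raddfB.
Qed.
HB.instance Definition _ :=
  GRing.isZmodMorphism.Build (H1 M) (H1 N) H1_map H1_map_is_zmod_morphism.

End Functoriality.
Arguments chain1_map {G L M N} f _ : simpl never.
Arguments chain2_map {G L M N} f _ : simpl never.

Section Shapiro.
Variables (G : groupType) (H : groupClosed G).
Local Notation HT := (subgroupT H).
Local Notation ZH := (trivmod HT).
Local Notation P := (permmod H).

Definition shapiro_coef : {additive ZH -> P} := mkmalgU (cosetL H 1%g).

Fact shapiro_coef_act (h : HT) (n : ZH) :
  shapiro_coef (zg_act h n) = zg_act (val h) (shapiro_coef n).
Proof.
rewrite /= /permmod_act [RHS]mliftU; congr << _ *g _ >>.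
rewrite cosetL_actE mulg1; apply/cosetLP.
by rewrite invg1 mul1g; exact: (valP h).
Qed.

(* Induced by the inclusion H -> G and the map Z -> Z[G/H], n |-> n (1 H). *)
Definition shapiro_pair : pairhom ZH P :=
  PairHom (ph_grp := (val : HT -> G)) shapiro_coef_act.

Definition shapiro : H1 ZH -> H1 P := H1_map shapiro_pair.

Local Notation shc := (chain1_map shapiro_pair).

Local Lemma shap_actP g (c : coset_space H) :
  ((repr c)^-1 * (g * repr (cosetL_act g^-1 c)) \in H)%g.
Proof.
apply/cosetLP; rewrite -cosetL_actE !cosetL_repr.
by rewrite -[c]cosetL_repr !cosetL_actE mulVKg.
Qed.

Local Definition kap (c : coset_space H) g : HT := SubgroupT (shap_actP g c).

Local Lemma kapM c g h :
  kap c (g * h)%g = (kap c g * kap (cosetL_act g^-1 c) h)%g.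
Proof.
apply/val_inj; rewrite valM /= -!mulgA; congr (_ * (_ * _))%g.
rewrite mulVKg; congr (_ * repr _)%g.
by rewrite -[c]cosetL_repr !cosetL_actE invgM mulgA.
Qed.

Local Definition ret1 : chain1 P -> chain1 ZH :=
  mlift (fun g => mlift (fun c => mkmalgU (kap c g))
    : {additive P -> chain1 ZH}).
HB.instance Definition _ := Algebra.Additive.on ret1.
Arguments ret1 _ : simpl never.

Local Lemma ret1U g c : ret1 << (<< c >> : P) *g g >> = << (1 : ZH) *g kap c g >>.
Proof. by rewrite [LHS]mliftU [LHS]mliftU. Qed.

Local Definition ret2 : chain2 P -> chain2 ZH :=
  mlift (fun gh : G * G =>
    mlift (fun c => mkmalgU (kap c gh.1, kap (cosetL_act gh.1^-1%g c) gh.2))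
    : {additive P -> chain2 ZH}).
HB.instance Definition _ := Algebra.Additive.on ret2.
Arguments ret2 _ : simpl never.

Local Lemma ret2U g h c : ret2 << (<< c >> : P) *g (g, h) >> =
  << (1 : ZH) *g (kap c g, kap (cosetL_act g^-1%g c) h) >>.
Proof. by rewrite [LHS]mliftU [LHS]mliftU. Qed.

Local Lemma permmod_ind (A : zmodType) (K : choiceType)
    (f g : {additive {malg P[K]} -> A}) :
  (forall k c, f << (<< c >> : P) *g k >> = g << (<< c >> : P) *g k >>) ->
  f =1 g.
Proof.
move=> fg; apply: malg_ext => k x.
apply: (malgZ_ext (f := f \o mkmalgU k) (g := g \o mkmalgU k)) => c.
exact: fg.
Qed.

Local Lemma ret_d2 z : bar_d2 (ret2 z) = ret1 (bar_d2 z).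
Proof.
apply: (permmod_ind (f := bar_d2 (M := ZH) \o ret2)
  (g := ret1 \o bar_d2 (M := P))) => -[g h] c.
rewrite /= ret2U !bar_d2U raddfD raddfB /=.
by rewrite [zg_act _ (<< c >> : P)]permmod_actU !ret1U kapM.
Qed.

Local Lemma modb_ret a b : modb a = modb b -> modb (ret1 a) = modb (ret1 b).
Proof.
move=> /modbP[c ec]; apply/modbP; exists (ret2 c).
by rewrite ret_d2 ec raddfB.
Qed.

Local Lemma modbV (L : groupType) (M : zgmod L) g (m : M) :
  modb << m *g g^-1%g >> = - modb << zg_act g m *g g >>.
Proof.
apply/eqP; rewrite -subr_eq0 opprK; apply/eqP.
by rewrite -[g in zg_act g]invgK -modbM mulVg modb1.
Qed.

Local Lemma retK z : modb (ret1 (shc z)) = modb z.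
Proof.
pose f : {additive chain1 ZH -> _} := modb \o (ret1 \o shc).
pose g : {additive chain1 ZH -> _} := modb.
apply: (malgZ_ext (f := f) (g := g)) => h; rewrite {}/f {}/g /=.
rewrite chain1_mapU ret1U.
set s := repr (cosetL H 1%g).
have sH : s \in H.
  have /eqmodP : cosetL H 1%g = cosetL H s by rewrite cosetL_repr.
  by rewrite /= /cosetL_rel invg1 mul1g.
pose sT : HT := SubgroupT sH.
have -> : kap (cosetL H 1%g) (val h) = (sT^-1 * (h * sT))%g.
  apply/val_inj; rewrite !valM /=; congr (_ * (_ * repr _))%g.
  rewrite cosetL_actE mulg1; apply/esym/cosetLP.
  by rewrite invg1 mul1g gpredV; exact: (valP h).
rewrite modbM modbV /= modbM /= addrCA addrA.
by rewrite -addrA addNr addr0.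
Qed.

Local Definition sec : P -> chain1 P :=
  mlift (fun c : coset_space H =>
    (mkmalgU (repr c) : {additive P -> chain1 P})
      \o (mkmalgU c : {additive int -> P})).
HB.instance Definition _ := Algebra.Additive.on sec.
Arguments sec _ : simpl never.

Local Lemma retVK z :
  modb (shc (ret1 z)) = modb z + modb (sec (bar_d1 z)).
Proof.
apply: (permmod_ind (f := modb (M := P) \o (shc \o ret1))
  (g := modb (M := P) \+ (modb (M := P) \o (sec \o bar_d1 (M := P)))))
  => g c /=.
rewrite ret1U chain1_mapU /= bar_d1U raddfB /=.
rewrite [zg_act _ (<< c >> : P)]permmod_actU ![sec _]mliftU /=.
rewrite /shapiro_coef /= modbM modbV modbM raddfB /= invgK.
have e x : zg_act x (<< cosetL H 1%g >> : P) = << cosetL H x >>.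
  by rewrite [LHS]permmod_actU cosetL_actE mulg1.
rewrite !e cosetL_repr [zg_act _ (<< c >> : P)]permmod_actU.
by rewrite addrC -addrA.
Qed.

Lemma shapiro_bij :
  exists inv : H1 P -> H1 ZH, cancel shapiro inv /\ cancel inv shapiro.
Proof.
have cyc (z : chain1 ZH) : bar_d1 z == 0.
  apply/eqP; apply: (malg_ext (f := bar_d1 (M := ZH)) (g := \0)) => k x.
  exact: etrans (bar_d1U k x) (subrr _).
exists (fun y => homcl (Cycle1 (cyc (ret1 (val (repr y)))))); split=> x.
  rewrite -[RHS]homcl_repr; apply/homcl_eq => /=.
  rewrite -[RHS]retK; apply/modb_ret.
  exact: (iffLR (homcl_eq (repr (shapiro x)) (cycle1_map shapiro_pair (repr x)))
    (homcl_repr _)).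
rewrite -[RHS]homcl_repr [LHS]H1_mapE; apply/homcl_eq => /=.
by rewrite retVK (eqP (valP (repr x))) !raddf0 addr0.
Qed.

Definition shapiro_inv : H1 P -> H1 ZH := sval (cid shapiro_bij).

Lemma shapiroK : cancel shapiro shapiro_inv.
Proof. by rewrite /shapiro_inv; case: cid => ? []. Qed.

Lemma shapiro_invK : cancel shapiro_inv shapiro.
Proof. by rewrite /shapiro_inv; case: cid => ? []. Qed.

End Shapiro.
Arguments shapiro {G H} _.
Arguments shapiro_inv {G H} _.

(* The composite H_1(G1) ~ H_1(G, Z[G/G1]) -> H_1(G, Z[G/G2]) ~ H_1(G2). *)
Definition shapiro_transport (G : groupType) (G1 G2 : groupClosed G)
    (psi : zghom (permmod G1) (permmod G2)) :
    H1 (trivmod (subgroupT G1)) -> H1 (trivmod (subgroupT G2)) :=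
  shapiro_inv \o H1_map (pair_of_zghom psi) \o shapiro.

Section Projection.
Variable G : groupType.

Fact h1proj_subproof (g : G) : bar_d1 (<< 1 *g g >> : chain1 (trivmod G)) == 0.
Proof. by rewrite (bar_d1U g (1 : trivmod G)) subrr. Qed.

(* The natural projection G -> H_1(G, Z), sending g to the class of [g]. *)
Definition h1proj (g : G) : H1 (trivmod G) := homcl (Cycle1 (h1proj_subproof g)).

Lemma h1projM g h : h1proj (g * h)%g = h1proj g + h1proj h.
Proof.
rewrite /h1proj -homclD; apply/homcl_eq.
apply/esym; rewrite [X in modb X]raddfD [LHS]raddfD; apply/esym.
exact: (modbM g h (1 : trivmod G)).
Qed.
End Projection.

Definition has_index (G : groupType) (H : groupClosed G) (n : nat) : Prop :=
  ([set: coset_space H] #= `I_n)%card.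

Definition zmod_has_index (A : zmodType) (U : zmodClosed A) (n : nat) : Prop :=
  ([set: Quotient.quot U] #= `I_n)%card.

Definition integral_gassmann (G : groupType) (G1 G2 : groupClosed G) : Prop :=
  [/\ finite_set [set: coset_space G1], finite_set [set: coset_space G2] &
    exists psi : zghom (permmod G1) (permmod G2), bijective psi].

Definition normalized_iso (G : groupType) (G1 G2 : groupClosed G)
    (psi : zghom (permmod G1) (permmod G2)) : Prop :=
  [/\ bijective psi,
    forall n, psi (permmod_diag G1 n) = permmod_diag G2 n &
    forall x, permmod_aug (psi x) = permmod_aug x].

Definition corresponding_h1 (G : groupType) (G1 G2 : groupClosed G)
    (psi : zghom (permmod G1) (permmod G2)) (t : nat)
    (U1 : zmodClosed (H1 (trivmod (subgroupT G1))))
    (U2 : zmodClosed (H1 (trivmod (subgroupT G2)))) : Prop :=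
  [/\ zmod_has_index U1 t, zmod_has_index U2 t &
    shapiro_transport psi @` [set` U1] = [set` U2]].

Definition corresponding (G : groupType) (G1 G2 : groupClosed G)
    (psi : zghom (permmod G1) (permmod G2)) (t : nat)
    (G1' : groupClosed (subgroupT G1)) (G2' : groupClosed (subgroupT G2)) :
    Prop :=
  exists U1 U2, [/\ corresponding_h1 psi t U1 U2,
    [set` G1'] = @h1proj (subgroupT G1) @^-1` [set` U1] &
    [set` G2'] = @h1proj (subgroupT G2) @^-1` [set` U2]].

Definition normal_core (G : groupType) (A : set G) : set G :=
  \bigcap_(g in [set: G]) [set (x ^ g)%g | x in A].

(* Main.v *)
(** An element n of G lies in the normal core of H iff it acts trivially on
    Z[G/H]; every x (x) [n] is then a cycle with coefficients in Z[G/H], and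
    Shapiro's isomorphism matches the class of gH (x) [n] with that of g^-1 n g
    in H_1(H). Hence n lies in the core of the preimage of U in H iff n acts
    trivially on Z[G/H] and, for all x in Z[G/H], the class of x (x) [n]
    corresponds to an element of U. A ZG-isomorphism psi sends x (x) [n] to
    psi(x) (x) [n], so this condition is the same on both sides. *)

From HB Require Import structures.
Require Import Defs.
From mathcomp Require Import all_boot all_order all_algebra.
From mathcomp Require Import finmap monalg.
From mathcomp Require Import boolp classical_sets functions cardinality fsbigop.

Set Implicit Arguments.
Unset Strict Implicit.
Unset Printing Implicit Defensive.

Import GRing.Theory.

Local Open Scope classical_set_scope.
Local Open Scope ring_scope.
Section PureCycles.
Variables (G : groupType) (M : zgmod G) (n : G).
Hypothesis fixn : forall x : M, zg_act n^-1%g x = x.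

(** The complex uses the right action x g = g^-1 x, so the boundary of x (x) [n] is n^-1 x - x;
    hence invariance is stated for [n^-1]. *)
Fact pure_cycle_subproof (x : M) : bar_d1 (<< x *g n >> : chain1 M) == 0.
Proof. by rewrite bar_d1U fixn subrr. Qed.

Definition pure_cycle (x : M) : cycle1 M := Cycle1 (pure_cycle_subproof x).

Definition pure_class (x : M) : H1 M := homcl (pure_cycle x).

Lemma pure_class_is_zmod_morphism : zmod_morphism pure_class.
Proof.
move=> x y; rewrite /pure_class -homclB; congr homcl; apply/val_inj.
by rewrite [RHS]raddfB /= raddfB.
Qed.
HB.instance Definition _ :=
  GRing.isZmodMorphism.Build M (H1 M) pure_class pure_class_is_zmod_morphism.

End PureCycles.

Lemma H1_map_pure_class (G : groupType) (M N : zgmod G) (f : zghom M N) (n : G)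
    (fixM : forall x : M, zg_act n^-1%g x = x)
    (fixN : forall x : N, zg_act n^-1%g x = x) (x : M) :
  H1_map (pair_of_zghom f) (pure_class fixM x) = pure_class fixN (f x).
Proof.
rewrite [LHS]H1_mapE; congr homcl; apply/val_inj.
exact: (chain1_mapU (pair_of_zghom f)).
Qed.

Section InverseHom.
Variables (G : groupType) (M N : zgmod G) (f : zghom M N).

(** Provides a ZG-linear inverse of psi, so that an inclusion of cores shown for one direction also
    yields the reverse one. *)
Lemma zghom_inverse : bijective f ->
  exists g : zghom N M, cancel f g /\ cancel g f.
Proof.
move=> [g fK gK].
have gB : zmod_morphism g by apply: can2_zmod_morphism fK gK.
pose ga : {additive N -> M} :=
  HB.pack g (GRing.isZmodMorphism.Build N M g gB).
have gact a y : ga (zg_act a y) = zg_act a (ga y).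
  by apply: (can_inj fK); rewrite /= zghom_act !gK.
by exists (ZGHom gact).
Qed.

Lemma H1_map_cancel (g : zghom N M) :
  cancel f g -> cancel (H1_map (pair_of_zghom f)) (H1_map (pair_of_zghom g)).
Proof.
move=> fK x; rewrite -[x]homcl_repr !H1_mapE; congr homcl; apply/val_inj => /=.
apply: (malg_ext (f := chain1_map (pair_of_zghom g)
   \o chain1_map (pair_of_zghom f)) (g := idfun)) => a y.
by rewrite /= !chain1_mapU /= fK.
Qed.

End InverseHom.

Section NormalCore.
Variables (G : groupType) (H : groupClosed G).
Local Notation P := (permmod H).
Local Notation HT := (subgroupT H).

Lemma normal_coreP (A : set G) (n : G) :
  normal_core A n <-> forall g, A (n ^ g)%g.
Proof.
split=> [core g|core g _]; last first.
  by exists (n ^ g^-1)%g; [exact: core | rewrite conjgKV].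
have [y Ay <-] := core g^-1%g I.
by rewrite conjgKV.
Qed.

(** The cosets form a basis permuted by n^-1, and n^-1 fixes gH exactly when g^-1 n g lies in H. *)
Lemma permmod_fixP (n : G) :
  (forall x : P, zg_act n^-1%g x = x) <-> (forall g, (n ^ g)%g \in H).
Proof.
have conjE g : (n ^ g \in H)%g = (cosetL H (n^-1 * g)%g == cosetL H g).
  rewrite -[(n ^ g)%g]/(g^-1 * (n * g))%g mulgA -{1}[n]invgK -invgM.
  by apply/cosetLP/eqP.
have actE g : zg_act n^-1%g (<< cosetL H g >> : P) = << cosetL H (n^-1 * g)%g >>.
  by rewrite [LHS]permmod_actU cosetL_actE.
split=> [fixn g|core x].
  (* Compare coefficients at gH: that of gH is 1, that of n^-1 gH is 1 or 0 according to whether the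
     two cosets agree. *)
  rewrite conjE; have /(congr1 (mcoeff (cosetL H g))) := fixn << cosetL H g >>.
  by rewrite actE !mcoeffU eqxx; case: (_ == _).
apply: (malgZ_ext (f := zg_act n^-1%g : {additive P -> P}) (g := idfun)) => c.
rewrite /= -[c]cosetL_repr actE.
by have := core (repr c); rewrite conjE => /eqP ->.
Qed.

(* Modulo boundaries, H (x) [g^-1 n g] is the sum of H (x) [g^-1], gH (x) [n]
   and gH (x) [g]; the first and the last cancel. *)
Lemma shapiro_h1proj_conj (n g : G) (fixn : forall x : P, zg_act n^-1%g x = x)
    (k : HT) : val k = (n ^ g)%g ->
  shapiro (h1proj k) = pure_class fixn << cosetL H g >>.
Proof.
move=> kE; rewrite [LHS]H1_mapE; apply/homcl_eq => /=.
have gE : zg_act g (<< cosetL H 1%g >> : P) = << cosetL H g >>.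
  by rewrite [LHS]permmod_actU cosetL_actE mulg1.
rewrite chain1_mapU /= kE conjgE modbM modbM invgK gE fixn.
rewrite [X in X + _]Defs.modbV gE.
by rewrite addrCA addNr addr0.
Qed.

Lemma shapiro_inv_is_zmod_morphism : zmod_morphism (@shapiro_inv G H).
Proof.
exact: (can2_zmod_morphism (f := H1_map (shapiro_pair H))
  (@shapiroK G H) (@shapiro_invK G H)).
Qed.
HB.instance Definition _ := GRing.isZmodMorphism.Build (H1 P)
  (H1 (trivmod HT)) (@shapiro_inv G H) shapiro_inv_is_zmod_morphism.

(** Restates membership in the core in terms that psi can transport. The existential acts as a
    conjunction, since [pure_class] takes the proof of invariance as an argument. *)
Lemma normal_core_h1P (U : zmodClosed (H1 (trivmod HT))) (H' : groupClosed HT)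
    (n : G) : [set` H'] = @h1proj HT @^-1` [set` U] ->
  normal_core (@sg_val G H @` [set` H']) n <->
  exists fixn : (forall x : P, zg_act n^-1%g x = x),
    forall x, shapiro_inv (pure_class fixn x) \in U.
Proof.
move=> H'E; have memH' (k : HT) : (k \in H') = (h1proj k \in U).
  by apply/idP/idP => kP;
    move/(congr1 (fun A => A k)): H'E => /= /propeqP[? ?]; auto.
rewrite normal_coreP; split=> [core|[fixn clU] g].
  have fixn : forall x : P, zg_act n^-1%g x = x.
    by apply/permmod_fixP => g; have [k _ <-] := core g; exact: sg_valP.
  (* Since [T] is additive and U is a subgroup, it is enough to treat single cosets. *)
  exists fixn; set T : {additive P -> _} := shapiro_inv \o pure_class fixn.
  move=> x; rewrite -[shapiro_inv _]/(T x) [x]monalgE raddf_sum.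
  apply: rpred_sum => c _.
  have -> : << x@_c *g c >> = (<< c >> : P) *~ x@_c.
    by rewrite -[in LHS](intz x@_c) raddfMz.
  rewrite raddfMz; apply: rpredMz.
  (* For c = gH, the class of c (x) [n] corresponds to that of g^-1 n g, which lies in H' and so has
     its class in U. *)
  have [k] := core (repr c); rewrite /= memH' => kU kE.
  by rewrite /T /= -[c]cosetL_repr -(shapiro_h1proj_conj fixn kE) shapiroK.
(* Conversely, invariance puts g^-1 n g in H, and the condition at x = gH puts its class in U. *)
have ngH := iffLR (permmod_fixP n) fixn g.
exists (SubgroupT ngH) => //=; rewrite memH'.
by rewrite -[h1proj _]shapiroK (shapiro_h1proj_conj fixn (g := g)).
Qed.

End NormalCore.

Lemma shapiro_transport_pure_class (G : groupType) (G1 G2 : groupClosed G)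
    (psi : zghom (permmod G1) (permmod G2)) (n : G)
    (fix1 : forall x : permmod G1, zg_act n^-1%g x = x)
    (fix2 : forall x : permmod G2, zg_act n^-1%g x = x) x :
  shapiro_transport psi (shapiro_inv (pure_class fix1 x)) =
  shapiro_inv (pure_class fix2 (psi x)).
Proof. by rewrite /shapiro_transport /= shapiro_invK H1_map_pure_class. Qed.

Lemma shapiro_transport_cancel (G : groupType) (G1 G2 : groupClosed G)
    (f : zghom (permmod G1) (permmod G2)) (g : zghom (permmod G2) (permmod G1)) :
  cancel f g -> cancel (shapiro_transport f) (shapiro_transport g).
Proof.
move=> fK x.
by rewrite /shapiro_transport /= shapiro_invK H1_map_cancel // shapiroK.
Qed.

(** One inclusion, in a form that applies to psi and to its inverse alike. Every y is f (g y), so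
    both invariance and membership of the classes pass along the equivariant map f. *)
Lemma normal_core_transport_sub (G : groupType) (G1 G2 : groupClosed G)
    (f : zghom (permmod G1) (permmod G2)) (g : zghom (permmod G2) (permmod G1))
    (U1 : zmodClosed (H1 (trivmod (subgroupT G1))))
    (U2 : zmodClosed (H1 (trivmod (subgroupT G2))))
    (G1' : groupClosed (subgroupT G1)) (G2' : groupClosed (subgroupT G2)) :
  cancel g f ->
  shapiro_transport f @` [set` U1] `<=` [set` U2] ->
  [set` G1'] = @h1proj (subgroupT G1) @^-1` [set` U1] ->
  [set` G2'] = @h1proj (subgroupT G2) @^-1` [set` U2] ->
  normal_core (@sg_val G G1 @` [set` G1']) `<=`
  normal_core (@sg_val G G2 @` [set` G2']).
Proof.
move=> gK fU G1E G2E n /(normal_core_h1P _ G1E)[fix1 clU].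
have fix2 (y : permmod G2) : zg_act n^-1%g y = y.
  by rewrite -[y]gK -zghom_act fix1.
apply/(normal_core_h1P _ G2E); exists fix2 => y.
rewrite -[y]gK -(shapiro_transport_pure_class f fix1).
by apply: fU; exists (shapiro_inv (pure_class fix1 (g y))) => //=; exact: clU.
Qed.

Theorem theorem5p4 (G : groupType) (G1 G2 : groupClosed G) (m t : nat)
    (gassmann : integral_gassmann G1 G2)
    (index1 : has_index G1 m) (index2 : has_index G2 m)
    (psi : zghom (permmod G1) (permmod G2))
    (psi_normalized : normalized_iso psi)
    (G1' : groupClosed (subgroupT G1)) (G2' : groupClosed (subgroupT G2))
    (index1' : has_index G1' t) (index2' : has_index G2' t)
    (corr : corresponding psi t G1' G2')
    (coprime_mt : gcdn m t = 1%N) :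
  normal_core (@sg_val G G1 @` [set` G1']) =
  normal_core (@sg_val G G2 @` [set` G2']).
Proof.
have [/zghom_inverse[phi [psiK phiK]] _ _] := psi_normalized.
have [U1 [U2 [[_ _ UE] G1E G2E]]] := corr.
rewrite eqEsubset; split.
  by apply: (normal_core_transport_sub phiK _ G1E G2E); rewrite UE.
apply: (normal_core_transport_sub psiK _ G2E G1E).
(* U2 is the image of U1 under the transport of [psi], which the transport of [phi] undoes; so U2 is
   sent into U1. *)
by rewrite -UE => _ [_ [u Uu <-] <-]; rewrite shapiro_transport_cancel.
Qed.
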